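(* Let $\mathbf{X}\subseteq\mathbb{R}^n$ contain the origin, let $\dot{\mathbf{x}}=\mathbf{f}(\mathbf{x})$ on $\mathbf{X}$ have flow $\mathbf{s}_t(\mathbf{x})$, with $\mathbf{f}$ at least $\mathcal{C}^1$ and with the origin a hyperbolic equilibrium point. Put $\mathbf{A}:=\frac{\partial\mathbf{f}}{\partial\mathbf{x}}(0)$ and $\mathbf{F}_n(\mathbf{x}):=\mathbf{f}(\mathbf{x})-\mathbf{A}\mathbf{x}$. Let $\lambda$ be an eigenvalue of $\mathbf{A}$ with $\mathrm{Re}(\lambda)>0$, let $\mathbf{w}_\lambda$ satisfy $\mathbf{w}_\lambda^\top\mathbf{A}=\lambda\mathbf{w}_\lambda^\top$, and let $\phi_\lambda(\mathbf{x})=\mathbf{w}_\lambda^\top\mathbf{x}+h_\lambda(\mathbf{x})$ be the principal Koopman eigenfunction for $\lambda$, with nonlinear part $h_\lambda$. Assume $h_\lambda$ is a continuous function of $\mathbf{x}$. Let $\mathcal{U}_\epsilon$ be the $\epsilon$-neighborhood of the origin and let $\mathcal{U}$ be a set such that for every $\mathbf{x}\in\mathcal{U}$ there exists a time $t(\mathbf{x})\ge 0$ with $\mathbf{s}_{t(\mathbf{x})}(\mathbf{x})\in\mathcal{U}_\epsilon$. Then $$\left|h_\lambda(\mathbf{x})-\int_0^{t(\mathbf{x})}e^{-\lambda\tau}\,\mathbf{w}_\lambda^\top\mathbf{F}_n(\mathbf{s}_\tau(\mathbf{x}))\,d\tau\right|\le\delta(\epsilon)$$ for some $\delta(\epsilon)>0$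 (depending on $\epsilon$ but not on $\mathbf{x}$) and all $\mathbf{x}\in\mathcal{U}$.
   Context: $\mathbf{X}$ is a smooth manifold without boundary or an open subset of $\mathbb{R}^n$, and $\mathbf{f}$ is smooth enough that solutions exist and are unique; $\mathbf{s}_t(\mathbf{x})$ is the solution at time $t$ starting from $\mathbf{x}$. An equilibrium is hyperbolic if the Jacobian of $\mathbf{f}$ there has no eigenvalue on the imaginary axis. A Koopman eigenfunction with eigenvalue $\lambda$ is a $\mathcal{C}^1$ function with $\phi_\lambda(\mathbf{s}_t(\mathbf{x}))=e^{\lambda t}\phi_\lambda(\mathbf{x})$, equivalently $\frac{\partial\phi_\lambda}{\partial\mathbf{x}}\mathbf{f}(\mathbf{x})=\lambda\phi_\lambda(\mathbf{x})$; it is called principal when $\lambda$ is an eigenvalue of $\mathbf{A}$. Its nonlinear part $h_\lambda(\mathbf{x})=\phi_\lambda(\mathbf{x})-\mathbf{w}_\lambda^\top\mathbf{x}$ satisfies $\frac{\partial h_\lambda}{\partial\mathbf{x}}\mathbf{f}(\mathbf{x})-\lambda h_\lambda(\mathbf{x})+\mathbf{w}_\lambda^\top\mathbf{F}_n(\mathbf{x})=0$. The $\epsilon$-neighborhood is $\mathcal{U}_\epsilon=\{\mathbf{y}:\|\mathbf{y}\|\le\epsilon\}$, contained in the domain on which $h_\lambda$ is defined, as are the trajectory segments $\{\mathbf{s}_\tau(\mathbf{x}):0\le\tau\le t(\mathbf{x})\}$ for $\mathbf{x}\in\mathcal{U}$. *)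

(* Defs.v *)
From HB Require Import structures.
From mathcomp Require Import all_boot all_order all_algebra.
From mathcomp Require Import complex.
From mathcomp Require Import all_classical all_reals all_analysis.

Set Implicit Arguments.
Unset Strict Implicit.
Unset Printing Implicit Defensive.

Import Order.TTheory GRing.Theory Num.Theory.
Import numFieldNormedType.Exports.

Local Open Scope classical_set_scope.
Local Open Scope ring_scope.

(* The norm carried by the normed module 'cV[R]_n is the sup norm. *)
Definition enorm (R : realType) (n : nat) (x : 'cV[R]_n) : R :=
  Num.sqrt (\sum_i x i ord0 ^+ 2).

Definition eps_neighborhood (R : realType) (n : nat) (eps : R) :
    set 'cV[R]_n := [set y | enorm y <= eps].

Definition cexp (R : realType) (z : R[i]) : R[i] :=
  Complex (expR (complex.Re z) * cos (complex.Im z))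
          (expR (complex.Re z) * sin (complex.Im z)).

Definition cintegral (R : realType) (T : R) (g : R -> R[i]) : R[i] :=
  Complex (Rintegral lebesgue_measure `[0, T] (fun tau => complex.Re (g tau)))
          (Rintegral lebesgue_measure `[0, T] (fun tau => complex.Im (g tau))).

Definition partial (R : realType) (n : nat) (W : normedModType R) (j : 'I_n)
    (g : 'cV[R]_n -> W) : 'cV[R]_n -> W :=
  fun x => 'D_(delta_mx j ord0) g x.

(* Meant for open D: g may take arbitrary values outside D. *)
Definition C1_on (R : realType) (n : nat) (W : normedModType R)
    (D : set 'cV[R]_n) (g : 'cV[R]_n -> W) : Prop :=
  forall x, D x ->
    differentiable g x /\ forall j, {for x, continuous (partial j g)}.

(* The library's [jacobian] is for maps between row vectors and is the
   transpose of this matrix. *)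
Definition Jacobian (R : realType) (n : nat) (f : 'cV[R]_n -> 'cV[R]_n)
    (x : 'cV[R]_n) : 'M[R]_n :=
  \matrix_(i, j) partial j (fun y => f y i ord0 : R) x.

Definition cmx (R : realType) (m n : nat) (M : 'M[R]_(m, n)) : 'M[R[i]]_(m, n) :=
  map_mx (real_complex R) M.

Definition hyperbolic_equilibrium (R : realType) (n : nat)
    (f : 'cV[R]_n -> 'cV[R]_n) (x : 'cV[R]_n) : Prop :=
  f x = 0 /\
  forall z : R[i], eigenvalue (cmx (Jacobian f x)) z -> complex.Re z != 0.

Definition nonlinear_vf (R : realType) (n : nat) (f : 'cV[R]_n -> 'cV[R]_n)
    (x : 'cV[R]_n) : 'cV[R]_n := f x - Jacobian f 0 *m x.

Definition lform (R : realType) (n : nat) (w : 'cV[R[i]]_n) (x : 'cV[R]_n) :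
    R[i] := (w^T *m cmx x) ord0 ord0.

Definition is_solution (R : realType) (n : nat) (X : set 'cV[R]_n)
    (f : 'cV[R]_n -> 'cV[R]_n) (J : set R) (x : 'cV[R]_n) (g : R -> 'cV[R]_n) :
    Prop :=
  [/\ open J, is_interval J, J 0, g 0 = x &
      forall t, J t -> X (g t) /\ is_derive t 1 g (f (g t))].

(* Solutions need not exist for all times: for x in X, Tmax x is the maximal
   interval of existence and s ^~ x is the unique solution on it; s t x is
   unspecified for t outside Tmax x. *)
Definition is_flow (R : realType) (n : nat) (X : set 'cV[R]_n)
    (f : 'cV[R]_n -> 'cV[R]_n) (Tmax : 'cV[R]_n -> set R)
    (s : R -> 'cV[R]_n -> 'cV[R]_n) : Prop :=
  forall x, X x ->
    is_solution X f (Tmax x) x (s ^~ x) /\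
    forall (J : set R) (g : R -> 'cV[R]_n), is_solution X f J x g ->
      J `<=` Tmax x /\ forall t, J t -> g t = s t x.

(* The library puts no topology on R[i]. *)
Definition C1_complex_on (R : realType) (n : nat) (D : set 'cV[R]_n)
    (phi : 'cV[R]_n -> R[i]) : Prop :=
  C1_on D (fun x => complex.Re (phi x) : R) /\
  C1_on D (fun x => complex.Im (phi x) : R).

Definition continuous_complex_on (R : realType) (n : nat) (D : set 'cV[R]_n)
    (h : 'cV[R]_n -> R[i]) : Prop :=
  {within D, continuous (fun x => complex.Re (h x) : R)} /\
  {within D, continuous (fun x => complex.Im (h x) : R)}.

(* D need not be invariant: the eigenfunction relation is required as long as
   the trajectory stays in D; t may be negative. *)
Definition koopman_eigenfunction (R : realType) (n : nat)
    (Tmax : 'cV[R]_n -> set R) (s : R -> 'cV[R]_n -> 'cV[R]_n)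
    (D : set 'cV[R]_n) (lambda : R[i]) (phi : 'cV[R]_n -> R[i]) : Prop :=
  C1_complex_on D phi /\
  forall x t, D x -> Tmax x t ->
    (forall tau : R, Num.min 0 t <= tau <= Num.max 0 t -> D (s tau x)) ->
    phi (s t x) = cexp (lambda * real_complex R t) * phi x.

(* Main.v *)
(* Along a trajectory, e^(- lambda tau) w^T s_tau(x) has derivative
   e^(- lambda tau) w^T F_n(s_tau(x)), since w^T A = lambda w^T. Integrating it
   and using phi(s_t(x)) = e^(lambda t) phi(x), the quantity to be bounded is
   exactly e^(- lambda t) h(s_t(x)) at t = t(x). Its modulus is at most the
   maximum of |h| over the compact eps-neighborhood, because Re lambda > 0 and
   t(x) >= 0. *)
Require Import Defs.
From HB Require Import structures.
From mathcomp Require Import all_boot all_order all_algebra.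
From mathcomp Require Import ring.
From mathcomp Require Import complex.
From mathcomp Require Import all_classical all_reals all_analysis.

Set Implicit Arguments.
Unset Strict Implicit.
Unset Printing Implicit Defensive.

Import Order.TTheory GRing.Theory Num.Theory.
Import numFieldNormedType.Exports.

Local Open Scope classical_set_scope.
Local Open Scope ring_scope.

(** * Complex arithmetic, the exponential and the linear form *)

Lemma Re_addc (R : realType) (x y : R[i]) :
  complex.Re (x + y) = complex.Re x + complex.Re y.
Proof. by case: x y => [a b] [c d]. Qed.

Lemma Re_subc (R : realType) (x y : R[i]) :
  complex.Re (x - y) = complex.Re x - complex.Re y.
Proof. by case: x y => [a b] [c d]. Qed.

Lemma Re_oppc (R : realType) (x : R[i]) : complex.Re (- x) = - complex.Re x.
Proof. by case: x. Qed.

Lemma Im_addc (R : realType) (x y : R[i]) :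
  complex.Im (x + y) = complex.Im x + complex.Im y.
Proof. by case: x y => [a b] [c d]. Qed.

Lemma Im_subc (R : realType) (x y : R[i]) :
  complex.Im (x - y) = complex.Im x - complex.Im y.
Proof. by case: x y => [a b] [c d]. Qed.

Lemma Re_mulc (R : realType) (x y : R[i]) :
  complex.Re (x * y) =
  complex.Re x * complex.Re y - complex.Im x * complex.Im y.
Proof. by case: x y => [a b] [c d]. Qed.

Lemma Im_mulc (R : realType) (x y : R[i]) :
  complex.Im (x * y) =
  complex.Re x * complex.Im y + complex.Im x * complex.Re y.
Proof. by case: x y => [a b] [c d]. Qed.

Lemma cexp0 (R : realType) : cexp 0 = 1 :> R[i].
Proof. by rewrite /cexp /= expR0 cos0 sin0 mul1r mulr0. Qed.

Lemma cexpD (R : realType) (x y : R[i]) : cexp (x + y) = cexp x * cexp y.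
Proof.
case: x y => [a b] [c d].
rewrite -[(Complex a b + Complex c d)%R]/(Complex (a + c) (b + d)).
apply/eqP; rewrite eq_complex /cexp /= expRD cosD sinD.
by apply/andP; split; apply/eqP; ring.
Qed.

Lemma normc_cexp (R : realType) (x : R[i]) :
  ComplexField.Normc.normc (cexp x) = expR (complex.Re x).
Proof.
by rewrite /= !exprMn -mulrDr cos2Dsin2 mulr1 sqrtr_sqr ger0_norm ?expR_ge0.
Qed.

(** The square of the right side exceeds that of the modulus by twice the product of the absolute
    values. This reduces bounding a complex function to bounding its two components. *)
Lemma normc_le_abs_add (R : realType) (x : R[i]) :
  ComplexField.Normc.normc x <= `|complex.Re x| + `|complex.Im x|.
Proof.
case: x => a b /=; rewrite -(@ler_pXn2r _ 2) ?nnegrE ?sqrtr_ge0 ?addr_ge0 //.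
rewrite sqr_sqrtr ?addr_ge0 ?sqr_ge0 // sqrrD !real_normK ?num_real //.
by rewrite lerD2r lerDl mulrn_wge0 // mulr_ge0.
Qed.

Lemma Re_lform (R : realType) (n : nat) (w : 'cV[R[i]]_n) (x : 'cV[R]_n) :
  complex.Re (lform w x) = \sum_i complex.Re (w i ord0) * x i ord0.
Proof.
rewrite /lform mxE (big_morph _ (@Re_addc R) (erefl (complex.Re 0))).
by apply: eq_bigr => i _; rewrite !mxE Re_mulc /= mulr0 subr0.
Qed.

Lemma Im_lform (R : realType) (n : nat) (w : 'cV[R[i]]_n) (x : 'cV[R]_n) :
  complex.Im (lform w x) = \sum_i complex.Im (w i ord0) * x i ord0.
Proof.
rewrite /lform mxE (big_morph _ (@Im_addc R) (erefl (complex.Im 0))).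
by apply: eq_bigr => i _; rewrite !mxE Im_mulc /= mulr0 add0r.
Qed.

Lemma lformB (R : realType) (n : nat) (w : 'cV[R[i]]_n) (x y : 'cV[R]_n) :
  lform w (x - y) = lform w x - lform w y.
Proof. by rewrite /lform /cmx map_mxB mulmxBr !mxE. Qed.

(** The left eigenvector relation turns w^T A x into lambda w^T x, which ties the integrand of the
    theorem to the velocity of w^T s_t(x). *)
Lemma lform_nonlinear_vf (R : realType) (n : nat) (f : 'cV[R]_n -> 'cV[R]_n)
    (lambda : R[i]) (w : 'cV[R[i]]_n) (x : 'cV[R]_n) :
  w^T *m cmx (Jacobian f 0) = lambda *: w^T ->
  lform w (nonlinear_vf f x) = lform w (f x) - lambda * lform w x.
Proof.
move=> wA; rewrite /nonlinear_vf lformB; congr (_ - _).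
by rewrite /lform /cmx map_mxM mulmxA -/(cmx (Jacobian f 0)) wA -scalemxAl !mxE.
Qed.

(** * Componentwise calculus for complex-valued functions *)

Definition is_cderive (R : realType) (F : R -> R[i]) (t : R) (dF : R[i]) : Prop :=
  is_derive t 1 (fun u => complex.Re (F u) : R) (complex.Re dF) /\
  is_derive t 1 (fun u => complex.Im (F u) : R) (complex.Im dF).

Definition ccontinuous_at (T : topologicalType) (R : realType) (F : T -> R[i])
    (t : T) : Prop :=
  complex.Re (F u) @[u --> t] --> (complex.Re (F t) : R) /\
  complex.Im (F u) @[u --> t] --> (complex.Im (F t) : R).

Lemma is_cderiveM (R : realType) (F G : R -> R[i]) (t : R) (dF dG : R[i]) :
  is_cderive F t dF -> is_cderive G t dG ->
  is_cderive (fun u => F u * G u) t (dF * G t + F t * dG).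
Proof.
move=> [F1 F2] [G1 G2]; split.
- rewrite (_ : (fun u => _) = (fun u => complex.Re (F u)) * (fun u => complex.Re (G u))
     - (fun u => complex.Im (F u)) * (fun u => complex.Im (G u))); last first.
    by apply/funext => u; rewrite Re_mulc.
  apply: is_derive_eq.
  rewrite Re_addc !Re_mulc /GRing.scale /=; ring.
- rewrite (_ : (fun u => _) = (fun u => complex.Re (F u)) * (fun u => complex.Im (G u))
     + (fun u => complex.Im (F u)) * (fun u => complex.Re (G u))); last first.
    by apply/funext => u; rewrite Im_mulc.
  apply: is_derive_eq.
  rewrite Im_addc !Im_mulc /GRing.scale /=; ring.
Qed.

Lemma is_cderive_continuous (R : realType) (F : R -> R[i]) (t : R) (dF : R[i]) :
  is_cderive F t dF -> ccontinuous_at F t.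
Proof.
by move=> [F1 F2]; split; apply/differentiable_continuous/derivable1_diffP.
Qed.

Lemma ccontinuousM (T : topologicalType) (R : realType) (F G : T -> R[i]) (t : T) :
  ccontinuous_at F t -> ccontinuous_at G t ->
  ccontinuous_at (fun u => F u * G u) t.
Proof.
move=> [F1 F2] [G1 G2]; split.
- by under eq_fun do rewrite Re_mulc; rewrite Re_mulc; apply: cvgB; apply: cvgM.
- by under eq_fun do rewrite Im_mulc; rewrite Im_mulc; apply: cvgD; apply: cvgM.
Qed.

Lemma ccontinuousB (T : topologicalType) (R : realType) (F G : T -> R[i]) (t : T) :
  ccontinuous_at F t -> ccontinuous_at G t ->
  ccontinuous_at (fun u => F u - G u) t.
Proof.
move=> [F1 F2] [G1 G2]; split.
- by under eq_fun do rewrite Re_subc; rewrite Re_subc; apply: cvgB.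
- by under eq_fun do rewrite Im_subc; rewrite Im_subc; apply: cvgB.
Qed.

(** With z = a + ib the components are e^(au) cos(bu) and e^(au) sin(bu); their real derivatives
    recombine into multiplication by z. *)
Lemma is_cderive_cexp (R : realType) (z : R[i]) (t : R) :
  is_cderive (fun u => cexp (z * real_complex R u)) t
    (z * cexp (z * real_complex R t)).
Proof.
case: z => a b; have E (u : R) : cexp (Complex a b * real_complex R u) =
    Complex (expR (a * u) * cos (b * u)) (expR (a * u) * sin (b * u)).
  by rewrite /cexp Re_mulc Im_mulc /= !mulr0 subr0 add0r.
split.
- under eq_fun do rewrite E.
  rewrite E Re_mulc /=; apply: is_derive_eq.
  rewrite /GRing.scale /=; ring.
- under eq_fun do rewrite E.
  rewrite E Im_mulc /=; apply: is_derive_eq.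
  rewrite /GRing.scale /=; ring.
Qed.

(** * Compactness of the closed Euclidean ball *)

Lemma trmx_continuous (R : numFieldType) (m n : nat) :
  continuous (@trmx R m n).
Proof.
move=> M A /= /nbhs_ballP[e e0 eA]; apply/nbhs_ballP; exists e => // N [_ MN].
by apply: eA; split => // i j; rewrite !mxE; exact: MN.
Qed.

Lemma enorm_continuous (R : realType) (n : nat) : continuous (@enorm R n).
Proof.
move=> x; apply: (@continuous_comp _ _ _ (fun x : 'cV[R]_n => \sum_i x i ord0 ^+ 2));
  last exact: sqrt_continuous.
apply: continuous_big => [|i _ y]; first exact: add_continuous.
apply: continuous_comp (@exprn_continuous _ 2 _); exact: coord_continuous.
Qed.

(** The ball is a closed subset of the box [-eps, eps]^n. The box is compact as a product of
    segments in row vectors, and transposition carries it continuously to column vectors. *)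
Lemma eps_neighborhood_compact (R : realType) (n : nat) (eps : R) :
  compact (eps_neighborhood eps : set 'cV[R]_n).
Proof.
pose box := [set v : 'rV[R]_n | forall i, `[- eps, eps]%classic (v ord0 i)].
have boxc : compact (trmx @` box).
  apply: continuous_compact; first exact/continuous_subspaceT/trmx_continuous.
  by apply: (@rV_compact _ _ (fun=> `[- eps, eps]%classic)) => _; exact: segment_compact.
apply: subclosed_compact boxc _ => [|x xe].
  apply: (@preimage_closed _ _ (@enorm R n) [set y : R | y <= eps]).
    by move=> x _; exact: enorm_continuous.
  exact: closed_le.
exists x^T; last exact: trmxK.
(* Each coordinate satisfies |x_i| = sqrt(x_i^2), and x_i^2 is one term of the sum of squares under
   the root in [enorm]. *)
move=> i; rewrite /= mxE in_itv /= -ler_norml -sqrtr_sqr.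
apply: le_trans xe; rewrite ler_wsqrtr // (bigD1 i) //= lerDl.
by apply: sumr_ge0 => j _; exact: sqr_ge0.
Qed.

(** * The linear form along a curve *)

Lemma is_derive_coord (R : realFieldType) (V : normedModType R) (m n : nat)
    (M : V -> 'M[R]_(m, n)) (t v : V) (dM : 'M[R]_(m, n)) i j :
  is_derive t v M dM -> is_derive t v (fun x => M x i j : R) (dM i j).
Proof.
move=> [Md <-]; split; first by move/derivable_mxP : Md.
by rewrite derive_mx // mxE.
Qed.

Lemma is_cderive_lform (R : realType) (n : nat) (w : 'cV[R[i]]_n)
    (g : R -> 'cV[R]_n) (t : R) (dg : 'cV[R]_n) :
  is_derive t 1 g dg -> is_cderive (fun u => lform w (g u)) t (lform w dg).
Proof.
(* Since the vectors are real, the components of the form are real linear forms with coefficients Re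
   w_i and Im w_i, so one real statement serves both. *)
have sumD (c : 'I_n -> R) : is_derive t 1 g dg ->
    is_derive t 1 (fun u => \sum_i c i * g u i ord0 : R) (\sum_i c i * dg i ord0).
  move=> gd; rewrite (_ : (fun u => _) = \sum_i (c i \*: (fun u => g u i ord0 : R))).
    by apply: is_derive_sum => i; apply: is_deriveZ; exact: is_derive_coord.
  by apply/funext => u; rewrite fct_sumE.
move=> gd; split.
- by under eq_fun do rewrite Re_lform; rewrite Re_lform; exact: sumD.
- by under eq_fun do rewrite Im_lform; rewrite Im_lform; exact: sumD.
Qed.

Lemma lform_ccontinuous (T : topologicalType) (R : realType) (n : nat)
    (w : 'cV[R[i]]_n) (g : T -> 'cV[R]_n) (t : T) :
  {for t, continuous g} -> ccontinuous_at (fun u => lform w (g u)) t.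
Proof.
move=> gc; have sumC (c : 'I_n -> R) :
    \sum_i c i * g u i ord0 @[u --> t] --> (\sum_i c i * g t i ord0 : R).
  apply: cvg_big => [|i _]; first exact: add_continuous.
  apply: cvgM; first exact: cvg_cst.
  apply: (cvg_comp g (fun M : 'cV[R]_n => M i ord0 : R)) gc _.
  exact: coord_continuous.
split.
- by under eq_fun do rewrite Re_lform; rewrite Re_lform; exact: sumC.
- by under eq_fun do rewrite Im_lform; rewrite Im_lform; exact: sumC.
Qed.

(** * The fundamental theorem of calculus on [0, T] *)

Lemma Rintegral_FTC (R : realType) (F G : R -> R) (T : R) : 0 <= T ->
  (forall t, 0 <= t <= T -> is_derive t 1 F (G t)) ->
  (forall t, 0 <= t <= T -> {for t, continuous G}) ->
  \int[lebesgue_measure]_(x in `[0, T]) G x = F T - F 0.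
Proof.
(* The case T = 0 is split off because [continuous_FTC2] is stated for a nondegenerate interval; the
   integral over a point is 0. *)
rewrite le_eqVlt => /predU1P[<- _ _|T0 FG Gc].
  by rewrite set_itv1 Rintegral_set1 subrr.
(* Two-sided derivatives are assumed at the endpoints too, which gives the one-sided continuity of
   [F] required there. *)
have Fc t : 0 <= t <= T -> {for t, continuous F}.
  by move=> /FG ?; apply/differentiable_continuous/derivable1_diffP.
rewrite /Rintegral (@continuous_FTC2 _ G F 0 T) //.
- by apply: continuous_in_subspaceT => t; rewrite inE /= in_itv /= => /Gc.
- split => [t|  |].
  + by rewrite in_itv /= => /andP[t0 tT]; have [] := FG t _; rewrite ?ltW.
  + by apply: cvg_at_right_filter; apply: Fc; rewrite lexx ltW.
  + by apply: cvg_at_left_filter; apply: Fc; rewrite lexx ltW.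
- move=> t; rewrite in_itv /= => /andP[t0 tT]; rewrite derive1E.
  by have /= [|_ ->] := FG t _; rewrite ?ltW.
Qed.

Lemma cintegral_FTC (R : realType) (F G : R -> R[i]) (T : R) : 0 <= T ->
  (forall t, 0 <= t <= T -> is_cderive F t (G t)) ->
  (forall t, 0 <= t <= T -> ccontinuous_at G t) ->
  cintegral T G = F T - F 0.
Proof.
move=> T0 FG Gc.
have ReE : \int[lebesgue_measure]_(u in `[0, T]) complex.Re (G u) =
    complex.Re (F T) - complex.Re (F 0).
  apply: (@Rintegral_FTC _ (fun u => complex.Re (F u))) => // t.
  - by move=> /FG[].
  - by move=> /Gc[].
have ImE : \int[lebesgue_measure]_(u in `[0, T]) complex.Im (G u) =
    complex.Im (F T) - complex.Im (F 0).
  apply: (@Rintegral_FTC _ (fun u => complex.Im (F u))) => // t.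
  - by move=> /FG[].
  - by move=> /Gc[].
by rewrite /cintegral ReE ImE; case: (F T) (F 0) => [a b] [c d].
Qed.

(** * The bound on the nonlinear part and the exact residual *)

Lemma ccontinuous_compact_bounded (R : realType) (n : nat) (K D : set 'cV[R]_n)
    (h : 'cV[R]_n -> R[i]) :
  compact K -> K `<=` D -> continuous_complex_on D h ->
  exists2 M : R, 0 < M &
    forall x, K x -> ComplexField.Normc.normc (h x) <= M.
Proof.
move=> Kc KD [h1 h2].
have bnd (g : 'cV[R]_n -> R) : {within D, continuous g} ->
    exists M : R, forall x, K x -> `|g x| <= M.
  move=> /(continuous_subspaceW KD)/continuous_compact/(_ Kc)/compact_bounded.
  (* Boundedness supplies every real strictly above [M] as a bound, hence [M + 1]. *)
  move=> [M [_ MP]]; exists (M + 1) => x Kx.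
  by apply: (MP (M + 1)); [rewrite ltrDl | exists x].
have [M1 M1P] := bnd _ h1; have [M2 M2P] := bnd _ h2.
(* For empty [K] the bounds [M1] and [M2] may be negative, hence the absolute values; the added 1
   keeps the bound positive even if [h] vanishes on [K]. *)
exists (`|M1| + `|M2| + 1); first by rewrite ltr_wpDl ?addr_ge0.
move=> x Kx; apply: le_trans (normc_le_abs_add _) _; rewrite ler_wpDr //.
by rewrite lerD // (le_trans _ (ler_norm _)) //; [exact: M1P | exact: M2P].
Qed.

Lemma koopman_residual (R : realType) (n : nat)
    (X : set 'cV[R]_n) (f : 'cV[R]_n -> 'cV[R]_n)
    (Tmax : 'cV[R]_n -> set R) (s : R -> 'cV[R]_n -> 'cV[R]_n)
    (lambda : R[i]) (w : 'cV[R[i]]_n)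
    (D : set 'cV[R]_n) (phi h : 'cV[R]_n -> R[i]) (x : 'cV[R]_n) (T : R) :
  C1_on X f -> is_flow X f Tmax s ->
  w^T *m cmx (Jacobian f 0) = lambda *: w^T ->
  koopman_eigenfunction Tmax s D lambda phi ->
  (forall y, D y -> phi y = lform w y + h y) ->
  X x -> 0 <= T -> Tmax x T -> (forall tau, 0 <= tau <= T -> D (s tau x)) ->
  h x - cintegral T (fun tau => cexp (- lambda * real_complex R tau)
                                * lform w (nonlinear_vf f (s tau x))) =
  cexp (- lambda * real_complex R T) * h (s T x).
Proof.
move=> fC1 sF wA [_ phiE] phiD Xx T0 TmaxT sD.
have [[_ Tmax_itv Tmax0 s0 s_sol] _] := sF _ Xx.
(* [Tmax x] is an interval containing 0 and [T], so the differential equation holds on all of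
   [0, T]. *)
have sol t : 0 <= t <= T -> X (s t x) /\ is_derive t 1 (s ^~ x) (f (s t x)).
  by move=> tT; apply: s_sol; exact: Tmax_itv tT.
have phiT : phi (s T x) = cexp (lambda * real_complex R T) * phi x.
  apply: phiE => //; first by rewrite -s0; apply: sD; rewrite lexx.
  by move=> tau; rewrite (min_idPl T0) (max_idPr T0); exact: sD.
pose E u := cexp (- lambda * real_complex R u).
rewrite (@cintegral_FTC _ (fun u => E u * lform w (s u x))) //; last 2 first.
(* The product rule gives -lambda E w^T s + E w^T f(s), which is E w^T F_n(s). *)
- move=> t /sol[_ sd]; rewrite (lform_nonlinear_vf _ wA).
  have := is_cderiveM (is_cderive_cexp (- lambda) t) (is_cderive_lform w sd).
  by congr is_cderive; rewrite /E; ring.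
- move=> t /sol[Xs sd]; apply: ccontinuousM.
    exact: is_cderive_continuous (is_cderive_cexp _ _).
  under eq_fun do rewrite (lform_nonlinear_vf _ wA).
  have sc : {for t, continuous (s ^~ x)}.
    exact/differentiable_continuous/derivable1_diffP.
  (* The trajectory stays in [X], where [f] is differentiable and so continuous. *)
  have fc : {for s t x, continuous f}.
    by apply: differentiable_continuous; have [] := fC1 _ Xs.
  apply: ccontinuousB; first exact/lform_ccontinuous/continuous_comp.
  apply: ccontinuousM; last exact: lform_ccontinuous.
  by split; exact: cvg_cst.
rewrite /E mulr0 cexp0 mul1r s0.
have EE : cexp (- lambda * real_complex R T) * cexp (lambda * real_complex R T) = 1.
  by rewrite -cexpD mulNr addNr cexp0.
have DT : D (s T x) by apply: sD; rewrite T0 lexx.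
have Dx : D x by rewrite -s0; apply: sD; rewrite lexx.
have hT : h (s T x) = phi (s T x) - lform w (s T x).
  by rewrite phiD // addrC addKr.
(* After h(s_T(x)) is replaced by e^(lambda T) (w^T x + h(x)) - w^T s_T(x), the exponentials cancel
   and both sides equal h(x) + w^T x - e^(- lambda T) w^T s_T(x). *)
rewrite hT phiT phiD // mulrBr mulrA EE; ring.
Qed.

Theorem theorem5 (R : realType) (n : nat)
    (X : set 'cV[R]_n) (f : 'cV[R]_n -> 'cV[R]_n)
    (Tmax : 'cV[R]_n -> set R) (s : R -> 'cV[R]_n -> 'cV[R]_n)
    (lambda : R[i]) (w : 'cV[R[i]]_n)
    (D : set 'cV[R]_n) (phi h : 'cV[R]_n -> R[i])
    (X_open : open X) (X0 : X 0)
    (f_C1 : C1_on X f) (f_hyp : hyperbolic_equilibrium f 0)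
    (s_flow : is_flow X f Tmax s)
    (lambda_eig : eigenvalue (cmx (Jacobian f 0)) lambda)
    (lambda_unstable : 0 < complex.Re lambda)
    (w_left : w^T *m cmx (Jacobian f 0) = lambda *: w^T)
    (D_open : open D) (D_sub : D `<=` X)
    (phi_eig : koopman_eigenfunction Tmax s D lambda phi)
    (phi_dec : forall x, D x -> phi x = lform w x + h x)
    (h_cont : continuous_complex_on D h) :
  exists delta : R -> R,
    forall eps : R, 0 < eps -> eps_neighborhood eps `<=` D ->
      0 < delta eps /\
      forall (U : set 'cV[R]_n) (t : 'cV[R]_n -> R),
        U `<=` X ->
        (forall x, U x ->
          [/\ 0 <= t x, Tmax x (t x), eps_neighborhood eps (s (t x) x) &
              forall tau : R, 0 <= tau <= t x -> D (s tau x)]) ->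
        forall x, U x ->
          ComplexField.Normc.normc
            (h x - cintegral (t x) (fun tau =>
                cexp (- lambda * real_complex R tau)
                * lform w (nonlinear_vf f (s tau x))))
          <= delta eps.
Proof.
(* The inclusion in [D] sits inside the existential so that [choice] yields a total function
   [delta], fixed before [U] and [t]. If the inclusion fails, 0 is a mere filler value. *)
have bnd (eps : R) : exists M : R, eps_neighborhood eps `<=` D ->
    0 < M /\ forall y, eps_neighborhood eps y -> ComplexField.Normc.normc (h y) <= M.
  have [epsD|] := pselect (eps_neighborhood eps `<=` D); last by exists 0.
  have [M M0 hM] :=
    ccontinuous_compact_bounded (@eps_neighborhood_compact R n eps) epsD h_cont.
  by exists M.
have [delta deltaP] := choice bnd.
exists delta => eps _ /deltaP[delta0 hM]; split => // U t UX Ut x Ux.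
have [t0 Tt st sD] := Ut x Ux.
rewrite (koopman_residual f_C1 s_flow w_left phi_eig phi_dec (UX _ Ux) t0 Tt sD).
rewrite ComplexField.Normc.normcM normc_cexp -[leRHS]mul1r.
apply: ler_pM; [exact: expR_ge0 | | | exact: hM].
  by case: (h _) => a b /=; exact: sqrtr_ge0.
rewrite -expR0 ler_expR Re_mulc Re_oppc /= mulr0 subr0 mulNr oppr_le0.
by rewrite mulr_ge0 // ltW.
Qed.
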